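(* Memory and randomization are necessary for relational Büchi properties with exact or approximate equality. Precisely: there exist an MDP $\mathcal{M}$, a state $s$, target sets $T_1,T_2$ and $\epsilon\ge0$ such that there exists a general scheduler $\sigma$ with $\Pr^{\sigma}_{s}(\mathbf{G}\mathbf{F}\,T_1)\approx_\epsilon\Pr^{\sigma}_{s}(\mathbf{G}\mathbf{F}\,T_2)$, but no memoryless (possibly randomized) scheduler and no deterministic (possibly history-dependent) scheduler satisfies this.
   Context: A Markov decision process (MDP) is a triple $\mathcal{M}=(S,\mathit{Act},\mathbf{P})$ with finite non-empty $S$, $\mathit{Act}$, and $\mathbf{P}:S\times\mathit{Act}\times S\to[0,1]$ such that each state has a non-empty set $\mathit{Act}(s)$ of enabled actions $\alpha$ with $\sum_{s'}\mathbf{P}(s,\alpha,s')=1$, and $\sum_{s'}\mathbf{P}(s,\alpha,s')=0$ otherwise. A (general) scheduler maps finite paths to probability distributions over the actions enabled in the last state; it is memoryless if its value depends only on the last state of the path, and deterministic if all its values are point distributions. $\Pr^\sigma_s(\mathbf{G}\mathbf{F}\,T)$ is the probability under $\sigma$ starting in $s$ of visiting $T\subseteq S$ infinitely often. $r\approx_\epsilon r'$ iff $|r-r'|\le\epsilon$ (exact equality is the case $\epsilon=0$). *)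

(* Defs.v *)
From HB Require Import structures.
From mathcomp Require Import all_boot all_order all_algebra.
From mathcomp Require Import all_classical all_reals all_analysis.
Set Implicit Arguments.
Unset Strict Implicit.
Unset Printing Implicit Defensive.
Import Order.TTheory GRing.Theory Num.Theory.
Import numFieldNormedType.Exports.

Local Open Scope classical_set_scope.
Local Open Scope ring_scope.

Record mdp (R : realType) := MDP {
  state : finType;
  act : finType;
  trans : state -> act -> state -> R;
  state_gt0 : (0 < #|state|)%N;
  act_gt0 : (0 < #|act|)%N;
  trans_itv : forall s a t, 0 <= trans s a t <= 1;
  trans_sum : forall s a, \sum_t trans s a t = 1 \/ \sum_t trans s a t = 0;
  trans_enabled : forall s, exists a, \sum_t trans s a t = 1
}.

Definition enabled R (M : mdp R) (s : state M) : {set act M} :=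
  [set a | \sum_t trans s a t == 1].

(* (s0, [:: (a0, s1); ...; (a_(n-1), s_n)]) stands for the alternating sequence
   s0 a0 s1 ... a_(n-1) s_n. *)
Definition history R (M : mdp R) : Type :=
  (state M * seq (act M * state M))%type.

Definition last_state R (M : mdp R) (h : history M) : state M :=
  last h.1 (map snd h.2).

Fixpoint walk R (M : mdp R) (s : state M) (l : seq (act M * state M)) : bool :=
  if l is (a, t) :: l' then (0 < trans s a t) && walk t l' else true.

Definition is_fpath R (M : mdp R) (h : history M) : bool := walk h.1 h.2.

(* A scheduler is a function on finite paths only: its values on the other
   histories are unconstrained, and irrelevant as these have probability 0. *)
Record scheduler R (M : mdp R) := Scheduler {
  sched :> history M -> act M -> R;
  sched_ge0 : forall h a, is_fpath h -> 0 <= sched h a;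
  sched_sum : forall h, is_fpath h -> \sum_a sched h a = 1;
  sched_enabled : forall h a, is_fpath h -> a \notin enabled (last_state h) ->
    sched h a = 0
}.

Definition memoryless R (M : mdp R) (sigma : scheduler M) : Prop :=
  forall h h' : history M, is_fpath h -> is_fpath h' ->
    last_state h = last_state h' -> forall a, sigma h a = sigma h' a.

Definition deterministic R (M : mdp R) (sigma : scheduler M) : Prop :=
  forall h : history M, is_fpath h ->
    exists a, forall b, sigma h b = (b == a)%:R.

(* (s0, k |-> (a_k, s_(k+1))) stands for s0 a0 s1 a1 s2 ... *)
Definition run R (M : mdp R) : Type :=
  (state M * (nat -> act M * state M))%type.

Definition state_at R (M : mdp R) (w : run M) (n : nat) : state M :=
  if n is k.+1 then (w.2 k).2 else w.1.

Section run_pointed.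
Context (R : realType) (M : mdp R).

Let state0 : state M := enum_val (Ordinal (state_gt0 M)).
Let act0 : act M := enum_val (Ordinal (act_gt0 M)).

HB.instance Definition _ := gen_eqMixin (run M).
HB.instance Definition _ := gen_choiceMixin (run M).
HB.instance Definition _ :=
  isPointed.Build (run M) (state0, fun=> (act0, state0)).

End run_pointed.

Definition cylinder R (M : mdp R) (h : history M) : set (run M) :=
  [set w | w.1 = h.1 /\ mkseq w.2 (size h.2) = h.2].

Definition runs R (M : mdp R) := g_sigma_algebraType (range (@cylinder R M)).
HB.instance Definition _ R (M : mdp R) := Measurable.on (runs M).

(* Probability, under sigma, that the history h is extended by the steps l. *)
Fixpoint ext_prob R (M : mdp R) (sigma : scheduler M) (h : history M)
    (l : seq (act M * state M)) : R :=
  if l is (a, t) :: l' then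
    sigma h a * trans (last_state h) a t *
      ext_prob sigma (h.1, rcons h.2 (a, t)) l'
  else 1.

Definition cyl_prob R (M : mdp R) (sigma : scheduler M) (s : state M)
    (h : history M) : R :=
  (h.1 == s)%:R * ext_prob sigma (h.1, [::]) h.2.

(* A consistent family q of prefix probabilities over a finite alphabet is
   realised by a random sequence on [0, 1[ with the Lebesgue measure: the points
   whose sequence has prefix h form an interval of length q h. This is only used
   to prove path_measure_exists. *)
Section nested_intervals.
Context (R : realType) (A : finType) (a0 : A) (q : seq A -> R).
Hypothesis q_ge0 : forall h, 0 <= q h.
Hypothesis q_nil : q [::] = 1.
Hypothesis q_rcons : forall h, \sum_a q (rcons h a) = q h.

Let below h (k : nat) := \sum_(b : A | (enum_rank b < k)%N) q (rcons h b).

Let left_end h := \sum_(i < size h) below (take i h) (enum_rank (nth a0 h i)).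

Let itv h x := left_end h <= x < left_end h + q h.

Let left_rcons h a : left_end (rcons h a) = left_end h + below h (enum_rank a).
Proof.
rewrite /left_end size_rcons big_ord_recr /= nth_rcons ltnn eqxx.
congr (_ + _); last by rewrite -cats1 take_size_cat.
apply: eq_bigr => i _; rewrite nth_rcons ltn_ord; congr below.
by rewrite -cats1 takel_cat // ltnW.
Qed.

Let below_mono h (j k : nat) : (j <= k)%N -> below h j <= below h k.
Proof.
move=> jk; rewrite /below [leRHS](bigID (fun b => (enum_rank b < j)%N)) /=.
rewrite (_ : \sum_(b | _ && (enum_rank b < j)%N) _ =
             \sum_(b | (enum_rank b < j)%N) q (rcons h b)).
  by rewrite lerDl sumr_ge0.
apply: eq_bigl => b; rewrite andb_idl // => bj; exact: leq_trans bj jk.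
Qed.

Let belowS h a :
  below h (enum_rank a).+1 = below h (enum_rank a) + q (rcons h a).
Proof.
rewrite /below (bigD1 a) //= addrC; congr (_ + _); apply: eq_bigl => b.
by rewrite ltnS [RHS]ltn_neqAle andbC -(inj_eq enum_rank_inj).
Qed.

Let below_all h : below h #|A| = q h.
Proof.
rewrite /below -q_rcons; apply: eq_bigl => b; exact: ltn_ord.
Qed.

Let itv_rcons h a x : itv (rcons h a) x =
  (below h (enum_rank a) <= x - left_end h < below h (enum_rank a).+1).
Proof. by rewrite /itv left_rcons belowS lerBrDl ltrBlDl addrA. Qed.

Let itv_parent h a x : itv (rcons h a) x -> itv h x.
Proof.
rewrite itv_rcons /itv => /andP[le1 lt1]; rewrite -subr_ge0 -ltrBlDl.
rewrite (lt_le_trans lt1) ?andbT; last by rewrite -below_all below_mono.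
by apply: le_trans le1; apply: sumr_ge0.
Qed.

Let itv_child h x : itv h x -> exists a, itv (rcons h a) x.
Proof.
rewrite {1}/itv -subr_ge0 -ltrBlDl => /andP[x0 xq].
have ex : exists k, x - left_end h < below h k.
  by exists #|A|; rewrite below_all.
case: (ex_minnP ex) => -[|k] xk mink.
  by move: xk; rewrite /below big_pred0 // ltNge x0.
have kA : (k < #|A|)%N by apply: mink; rewrite below_all.
exists (enum_val (Ordinal kA)); rewrite itv_rcons enum_valK /= xk andbT.
by rewrite leNgt; apply/negP => /mink; rewrite ltnn.
Qed.

Let itv_inj h a b x : itv (rcons h a) x -> itv (rcons h b) x -> a = b.
Proof.
rewrite !itv_rcons => /andP[la ra] /andP[lb rb].
apply: enum_rank_inj; apply/val_inj/eqP; rewrite eqn_leq.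
apply/andP; split; rewrite leqNgt; apply/negP => /(below_mono h).
  by move=> /(lt_le_trans rb)/lt_le_trans/(_ la); rewrite ltxx.
by move=> /(lt_le_trans ra)/lt_le_trans/(_ lb); rewrite ltxx.
Qed.

Let next x h := odflt a0 [pick a | itv (rcons h a) x].

Fixpoint itv_prefix x n :=
  if n is k.+1 then rcons (itv_prefix x k) (next x (itv_prefix x k)) else [::].

Definition itv_seq x n := next x (itv_prefix x n).

Lemma mkseq_itv_seq x n : mkseq (itv_seq x) n = itv_prefix x n.
Proof.
elim: n => // n IH.
by rewrite /mkseq -addn1 iotaD map_cat [map _ _]IH cats1 addn1.
Qed.

Let itv0 x : itv [::] x = (0 <= x < 1).
Proof. by rewrite /itv /left_end big_ord0 q_nil add0r. Qed.

Let itv_prefixP x n : 0 <= x < 1 -> itv (itv_prefix x n) x.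
Proof.
move=> x01; elim: n => [|n IH]; first by rewrite itv0.
rewrite /= /next; case: pickP => //= noa.
by have [a] := itv_child IH; rewrite noa.
Qed.

Let itv_prefix_out x n : ~~ (0 <= x < 1) -> itv_prefix x n = nseq n a0.
Proof.
move=> x01; have out h : itv h x = false.
  elim/last_ind: h => [|h a IH]; first by rewrite itv0 (negbTE x01).
  by apply/negP => /itv_parent; rewrite IH.
elim: n => //= n ->; rewrite /next; case: pickP => [a|_]; first by rewrite out.
by rewrite -cats1 -(nseqD n 1) addn1.
Qed.

Let itv_prefix_itv x h : itv h x -> itv_prefix x (size h) = h.
Proof.
elim/last_ind: h => //= h a IH xa; rewrite size_rcons /= (IH (itv_parent xa)).
congr rcons; rewrite /next; case: pickP => [b xb|/(_ a)]; last by rewrite xa.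
exact: itv_inj xb xa.
Qed.

Lemma itv_seq_preimage h :
  [set x | mkseq (itv_seq x) (size h) = h] `&` `[0, 1[%classic =
  `[left_end h, left_end h + q h[%classic.
Proof.
apply/seteqP; split => x /=; rewrite mkseq_itv_seq !in_itv /=.
  by move=> [hE /(itv_prefixP (size h))]; rewrite hE.
move=> xh; rewrite itv_prefix_itv //; split=> //.
by elim/last_ind: h xh => [|h a IH /itv_parent //]; rewrite -/(itv _ _) itv0.
Qed.

Lemma itv_seq_measure h :
  lebesgue_measure
    ([set x | mkseq (itv_seq x) (size h) = h] `&` `[0, 1[%classic) = (q h)%:E.
Proof.
rewrite itv_seq_preimage lebesgue_measure_itv /= lte_fin ltrDl.
have := q_ge0 h; rewrite le_eqVlt => /predU1P[<-|qh]; first by rewrite ltxx.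
by rewrite qh -EFinB addrAC subrr add0r.
Qed.

Lemma itv_seq_measurable h :
  measurable [set x : R | mkseq (itv_seq x) (size h) = h].
Proof.
rewrite -[X in measurable X](setUIDK _ `[0, 1[%classic).
apply: measurableU; first by rewrite itv_seq_preimage; exact: measurable_itv.
rewrite (_ : _ `\` _ =
    if h == nseq (size h) a0 then ~` `[0, 1[%classic else set0).
  by case: ifP => _ //; apply: measurableC; exact: measurable_itv.
apply/seteqP; split => x /=.
  rewrite mkseq_itv_seq in_itv /= => -[hE /negP xn].
  by rewrite -hE itv_prefix_out // size_nseq eqxx /= in_itv; exact/negP.
case: ifPn => // /eqP hE /=; rewrite mkseq_itv_seq in_itv /= => xn; split => //.
by rewrite itv_prefix_out //; exact/negP.
Qed.

End nested_intervals.

Section unit_lebesgue.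
Context (R : realType).

Definition unit_lebesgue : set (measurableTypeR R) -> \bar R :=
  mrestr (@lebesgue_measure R) (measurable_itv `[0, 1[).

HB.instance Definition _ := Measure.on unit_lebesgue.

Let unit_lebesgueT : unit_lebesgue setT = 1%E.
Proof.
rewrite /unit_lebesgue /mrestr setTI lebesgue_measure_itv /= lte_fin ltr01.
by rewrite oppr0 adde0.
Qed.

HB.instance Definition _ :=
  Measure_isProbability.Build _ _ _ unit_lebesgue unit_lebesgueT.

End unit_lebesgue.

Section path_measure.
Context (R : realType) (M : mdp R) (sigma : scheduler M) (s : state M).

Let q := ext_prob sigma (s, [::]).

Let ext_prob_rcons h l a t : ext_prob sigma h (rcons l (a, t)) =
  ext_prob sigma h l *
    (sigma (h.1, h.2 ++ l) a * trans (last_state (h.1, h.2 ++ l)) a t).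
Proof.
elim: l h => [|[b u] l IH] [s0 l0] /=; first by rewrite cats0 mulr1 mul1r.
by rewrite IH /= cat_rcons mulrA.
Qed.

Let walk_rcons (s0 : state M) l a t : walk s0 (rcons l (a, t)) =
  walk s0 l && (0 < trans (last_state (s0, l)) a t).
Proof.
elim: l s0 => [|[b u] l IH] s0 /=; first by rewrite andbT.
by rewrite IH andbA.
Qed.

Let q_out l : ~~ walk s l -> q l = 0.
Proof.
elim/last_ind: l => // l [a t] IH.
rewrite walk_rcons negb_and /q ext_prob_rcons -/(q l).
case/orP=> [/IH ->|]; first by rewrite mul0r.
rewrite -leNgt => le0; rewrite (_ : @trans R M _ _ _ = 0) ?mulr0 //.
apply/eqP; rewrite eq_le le0.
by have /andP[] := trans_itv (last_state (s, l)) a t.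
Qed.

Let q_ge0 l : 0 <= q l.
Proof.
elim/last_ind: l => [|l [a t] IH]; first by rewrite /q ler01.
rewrite /q ext_prob_rcons /= -/(q l).
have [wl|/q_out ->] := boolP (walk s l); last by rewrite mul0r.
rewrite mulr_ge0 // mulr_ge0 ?sched_ge0 //.
by have /andP[] := trans_itv (last_state (s, l)) a t.
Qed.

Let q_rcons l : \sum_x q (rcons l x) = q l.
Proof.
transitivity (\sum_a \sum_t q (rcons l (a, t))).
  by rewrite pair_bigA; apply: eq_bigr => -[].
transitivity (q l *
    \sum_a sigma (s, l) a * \sum_t trans (last_state (s, l)) a t).
  rewrite mulr_sumr; apply: eq_bigr => a _; rewrite mulrA mulr_sumr.
  by apply: eq_bigr => t _; rewrite /q ext_prob_rcons mulrA.
have [|/q_out ->] := boolP (walk s l); last by rewrite mul0r.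
rewrite -[walk s l]/(is_fpath (s, l)) => wl.
rewrite -[RHS]mulr1; congr (_ * _); rewrite -(sched_sum sigma wl).
apply: eq_bigr => a _.
have [] := boolP (a \in enabled (last_state (s, l))).
  by rewrite inE => /eqP ->; rewrite mulr1.
by move=> /(sched_enabled sigma wl) ->; rewrite mul0r.
Qed.

Let step0 : act M * state M := (point : run M).2 0%N.

Let sample (x : measurableTypeR R) : runs M := (s, itv_seq step0 q x).

Let sample_cylinder h : sample @^-1` cylinder h =
  if h.1 == s then [set x | mkseq (itv_seq step0 q x) (size h.2) = h.2]
  else set0.
Proof.
case: eqP => [hs|hs]; apply/seteqP; split => x //=; first by case.
by case=> /esym.
Qed.

Let measurable_sample : measurable_fun setT sample.
Proof.
have := @measurability _ _ (measurableTypeR R) (runs M) setT sample.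
apply; first by [].
move=> _ [_ [h _ <-] <-]; rewrite setTI sample_cylinder; case: ifP => _ //.
exact: itv_seq_measurable.
Qed.

HB.instance Definition _ :=
  isMeasurableFun.Build _ _ _ _ sample measurable_sample.

Lemma path_measure_exists :
  exists P : probability (runs M) R,
    forall h, P (cylinder h) = (cyl_prob sigma s h)%:E.
Proof.
exists (distribution (@unit_lebesgue R) sample) => h.
rewrite -[LHS]/(@unit_lebesgue R (sample @^-1` cylinder h)) sample_cylinder.
rewrite /cyl_prob.
case: eqP => [hs|_]; last by rewrite measure0 mul0r.
by rewrite hs mul1r -(itv_seq_measure step0 q_ge0 erefl q_rcons).
Qed.

End path_measure.

Definition path_measure R (M : mdp R) (sigma : scheduler M) (s : state M) :
    probability (runs M) R :=
  sval (cid (path_measure_exists sigma s)).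

Lemma path_measureE R (M : mdp R) (sigma : scheduler M) (s : state M) h :
  path_measure sigma s (cylinder h) = (cyl_prob sigma s h)%:E.
Proof. by rewrite /path_measure; case: cid => P /= ->. Qed.

Lemma path_measure_unique R (M : mdp R) (sigma : scheduler M) (s : state M)
    (P : probability (runs M) R) :
  (forall h, P (cylinder h) = (cyl_prob sigma s h)%:E) ->
  forall A, measurable A -> P A = path_measure sigma s A.
Proof.
move=> PE A mA.
pose G : set (set (runs M)) := [set set0; setT] `|` range (@cylinder R M).
have GE : @measurable _ (runs M) = <<s G >>.
  apply/seteqP; split.
    apply: smallest_sub; first exact: smallest_sigma_algebra.
    by move=> B GB; apply: sub_sigma_algebra; right.
  apply: smallest_sub; first exact: sigma_algebra_measurable.
  move=> B [[->|->]|] //.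
  exact: sub_sigma_algebra.
apply: (@measure_unique _ R (runs M) G (fun=> setT)) => //.
- move=> B C [[->|->]|[h _ <-]]; rewrite ?set0I ?setTI => GC //.
    by left; left.
  case: GC => [[->|->]|[h' _ <-]]; rewrite ?setI0 ?setIT.
  + by left; left.
  + by right; exists h.
  wlog: h h' / (size h.2 <= size h'.2)%N.
    move=> H; case: (leqP (size h.2) (size h'.2)) => [/H//|/ltnW/H].
    by rewrite setIC.
  move=> hh'.
  have [E|E] := pselect (h'.1 = h.1 /\ take (size h.2) h'.2 = h.2).
    right; exists h' => //; apply/seteqP; split=> w; last by case.
    case: E => E1 E2 [w1 w2]; split; split=> //; first by rewrite w1.
    by rewrite -[RHS]E2 -w2 -map_take take_iota (minn_idPl hh').
  left; left; apply/seteqP; split=> w //= -[[w1 w2] [w1' w2']]; apply: E.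
  by rewrite -w1' w1 -w2' -map_take take_iota (minn_idPl hh').
- by move=> _; left; right.
- by rewrite bigcup_const.
- move=> B [[->|->]|[h _ <-]].
  + by rewrite !measure0.
  + exact: etrans (probability_setT _) (esym (probability_setT _)).
  exact: etrans (PE h) (esym (path_measureE sigma s h)).
- move=> _; apply: (le_lt_trans (probability_le1 P measurableT)).
  by rewrite ltry.
Qed.

Definition buchi R (M : mdp R) (T : {set state M}) : set (runs M) :=
  [set w | forall n, exists2 m, (n <= m)%N & state_at w m \in T].

Lemma buchi_measurable R (M : mdp R) (T : {set state M}) :
  measurable (buchi T).
Proof.
have mc h : @measurable _ (runs M) (cylinder h).
  by apply: sub_sigma_algebra; exists h.
have ms m : @measurable _ (runs M) [set w | state_at w m \in T].
  pose F (h : history M) : set (runs M) :=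
    if (size h.2 == m) && (last_state h \in T) then cylinder h else set0.
  rewrite (_ : [set w | _] = \bigcup_h F h).
    apply: countable_bigcupT_measurable => [|h]; first exact: countableP.
    by rewrite /F; case: ifP.
  have lastE w : last_state (w.1, mkseq w.2 m) = state_at w m.
    case: m {F} => // m.
    by rewrite /last_state /mkseq -[in iota _ _]addn1 iotaD !map_cat last_cat.
  apply/seteqP; split=> w /=.
    move=> wT; exists (w.1, mkseq w.2 m); rewrite // /F /= size_mkseq eqxx.
    by rewrite lastE wT; split; rewrite //= size_mkseq.
  move=> [h _]; rewrite /F; case: ifP => // /andP[/eqP hm hT] [w1 w2].
  by rewrite -lastE w1 -hm w2; case: h hT {w1 w2 hm}.
rewrite (_ : buchi T = \bigcap_n \bigcup_(m in [set m | (n <= m)%N])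
    [set w | state_at w m \in T]).
  apply: bigcapT_measurable => n; exact: bigcup_measurable.
apply/seteqP; split=> w /= H n; first by move=> _; have [m] := H n; exists m.
by have [] // := H n; move=> m; exists m.
Qed.

Definition Pr_buchi R (M : mdp R) (sigma : scheduler M) (s : state M)
    (T : {set state M}) : R :=
  fine (path_measure sigma s (buchi T)).

Definition approx_eq (R : realType) (eps r r' : R) : Prop := `|r - r'| <= eps.

(* Main.v *)
Require Import Defs.
From mathcomp Require Import all_boot all_order all_algebra.
From mathcomp Require Import all_classical all_reals all_analysis.
From mathcomp Require Import lra.
Set Implicit Arguments.
Unset Strict Implicit.
Import Order.TTheory GRing.Theory Num.Theory.
Import numFieldNormedType.Exports.
Local Open Scope classical_set_scope.
Local Open Scope ring_scope.

(** Take a state [false] that can be kept forever or left, once and for all, for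
    an absorbing state [true], with [T1 = {false}] and [T2 = {true}].  Almost
    surely exactly one of the two Büchi conditions holds, and the first one
    holds iff the run never leaves [false]; so the two probabilities are equal
    iff the probability [c] of never leaving is 1/2.  A fair coin toss at the
    first step only, waiting ever after, achieves this.  A memoryless scheduler
    waiting with probability [p] has [c = lim p ^ n], and a deterministic one
    has [c] the limit of a product of zeros and ones: both are 0 or 1. *)

(** * Almost sure properties of the runs of an arbitrary MDP *)

Section almost_sure_paths.
Context (R : realType) (M : mdp R).

(** A run is an arbitrary sequence of steps; this singles out those that start in [s] and only take
    transitions of positive probability. *)
Definition infinite_path (s : state M) (w : runs M) : Prop :=
  w.1 = s /\ forall n, walk s (mkseq w.2 n).

Lemma ext_prob_out (sigma : scheduler M) (h : history M) l :
  ~~ walk (last_state h) l -> ext_prob sigma h l = 0.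
Proof.
elim: l h => // -[a t] l IH h /=; rewrite negb_and => /orP[|nw].
  rewrite -leNgt => le0; suff -> : trans (last_state h) a t = 0.
    by rewrite mulr0 mul0r.
  by apply/eqP; rewrite eq_le le0; case/andP: (trans_itv (last_state h) a t).
by rewrite IH ?mulr0 // /last_state /= map_rcons last_rcons.
Qed.

Lemma cylinder_measurable (h : history M) :
  measurable (cylinder h : set (runs M)).
Proof. by apply: sub_sigma_algebra; exists h. Qed.

(** Any other run has a finite prefix that starts elsewhere or takes an impossible transition. The
    cylinder of such a prefix is null, and there are only countably many histories. *)
Lemma infinite_path_ae (sigma : scheduler M) (s : state M) :
  {ae path_measure sigma s, forall w, infinite_path s w}.
Proof.
pose N (h : history M) : set (runs M) :=
  if (h.1 == s) && walk s h.2 then set0 else cylinder h.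
have N0 h : (path_measure sigma s).-negligible (N h).
  rewrite /N; case: ifPn => [_|]; first exact: negligible_set0.
  rewrite negb_and => out; exists (cylinder h).
  split; [exact: cylinder_measurable| |by []].
  rewrite [LHS]path_measureE /cyl_prob; case: eqP out => [->|_ _] /=.
    by move=> out; rewrite ext_prob_out ?mulr0.
  by rewrite mul0r.
(* Enumerates the null sets by natural numbers; numbers that code no history get the empty set. *)
pose F n := if unpickle n is Some h then N h else set0.
suff: (path_measure sigma s).-negligible (~` infinite_path s) by [].
apply: (@negligibleS _ _ _ _ (\bigcup_n F n)); last first.
  apply: negligible_bigcup => n; rewrite /F; case: unpickle => [h|] //.
  exact: negligible_set0.
move=> w /= nw; apply: contrapT => wN; apply: nw.
have inN n : (w.1 == s) && walk s (mkseq w.2 n).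
  apply: contrapT => /negP/negbTE E; apply: wN.
  exists (pickle (w.1 : state M, mkseq w.2 n)) => //.
  by rewrite /F pickleK /N /= E; split; rewrite //= size_mkseq.
split; first by case/andP: (inN 0%N) => /eqP.
by move=> n; case/andP: (inN n).
Qed.

(** Reduces equality of probabilities to pathwise reasoning on infinite paths. *)
Lemma eq_path_measure (sigma : scheduler M) (s : state M) (A B : set (runs M)) :
  measurable A -> measurable B ->
  (forall w, infinite_path s w -> A w <-> B w) ->
  path_measure sigma s A = path_measure sigma s B.
Proof.
have [N [mN N0 subN]] := infinite_path_ae sigma s.
have le A' B' : measurable A' -> measurable B' ->
    (forall w, infinite_path s w -> A' w -> B' w) ->
    (path_measure sigma s A' <= path_measure sigma s B')%E.
  (* Enlarging [B'] by the null set [N] turns the almost sure inclusion into a genuine one. *)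
  move=> mA mB AB; rewrite -(measureU0 mB mN N0).
  apply: le_measure; rewrite ?inE //; first exact: measurableU.
  move=> w Aw; have [/AB|/subN] := pselect (infinite_path s w); last by right.
  by left; auto.
by move=> mA mB AB; apply/eqP; rewrite eq_le !le // => w /AB [].
Qed.

Lemma walk_rcons (s : state M) l a t :
  walk s (rcons l (a, t)) = walk s l && (0 < trans (last_state (s, l)) a t).
Proof.
elim: l s => [|[b u] l IH] s /=; first by rewrite andbT.
by rewrite IH andbA.
Qed.

Lemma last_state_mkseq (w : runs M) n :
  last_state (w.1, mkseq w.2 n) = state_at w n.
Proof. by case: n => // n; rewrite /last_state mkseqS map_rcons last_rcons. Qed.

Lemma infinite_path_step (s : state M) (w : runs M) n :
  infinite_path s w -> 0 < trans (state_at w n) (w.2 n).1 (state_at w n.+1).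
Proof.
move=> [<- /(_ n.+1)].
rewrite mkseqS -last_state_mkseq /=; case: (w.2 n) => a t.
by rewrite walk_rcons => /andP[].
Qed.

End almost_sure_paths.

(** * The two-state MDP and its runs *)

Section wait_or_leave.
Context (R : realType).

(** As [||] binds tighter than [==], the only successor is [s || a]: action [true] leaves and
    [false] waits. Transitions are deterministic, so all randomness comes from the scheduler. *)
Definition leave_trans (s a t : bool) : R := (t == s || a)%:R.

Lemma leave_trans_itv s a t : 0 <= leave_trans s a t <= 1.
Proof. by rewrite /leave_trans ler0n lern1 leq_b1. Qed.

Lemma leave_trans_sum s a : \sum_t leave_trans s a t = 1.
Proof.
by rewrite big_bool /leave_trans; case: s a => [] []; rewrite /= ?addr0 ?add0r.
Qed.

Lemma bool_gt0 : (0 < #|{: bool}|)%N.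
Proof. by rewrite card_bool. Qed.

Definition leave_mdp : mdp R :=
  @MDP R bool bool leave_trans bool_gt0 bool_gt0 leave_trans_itv
    (fun s a => or_introl (leave_trans_sum s a))
    (fun s => ex_intro _ false (leave_trans_sum s false)).

Notation M := leave_mdp.

Definition wait (n : nat) : history M := (false, nseq n (false, false)).

(** Written as a decreasing intersection of cylinders so that its measure is a limit of cylinder
    probabilities. *)
Definition never_leave : set (runs M) := \bigcap_n cylinder (wait n).

Lemma wait_fpath n : is_fpath (wait n).
Proof. by rewrite /is_fpath; elim: n => //= n ->; rewrite ltr01. Qed.

Lemma last_state_wait n : last_state (wait n) = false.
Proof. by rewrite /last_state /=; elim: n. Qed.

Lemma never_leave_measurable : measurable never_leave.
Proof. by apply: bigcapT_measurable => n; exact: cylinder_measurable. Qed.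

Lemma leave_step (w : runs M) n : infinite_path (false : state M) w ->
  state_at w n.+1 = state_at w n || (w.2 n).1 :> bool.
Proof.
by move=> /infinite_path_step -/(_ n); rewrite ltr0n lt0b => /eqP.
Qed.

Lemma leave_absorbing (w : runs M) m n : infinite_path (false : state M) w ->
  (m <= n)%N -> state_at w m = true :> bool -> state_at w n = true :> bool.
Proof.
move=> pw /subnK <- wm; elim: (n - m)%N => // k IH.
by rewrite addSn leave_step // IH.
Qed.

Lemma never_leaveP (w : runs M) : infinite_path (false : state M) w ->
  never_leave w <-> forall n, state_at w n = false :> bool.
Proof.
move=> pw; split=> [nw [|n]|wF n _].
- by case: (nw 0%N I).
- have [_ /(congr1 (fun l => nth (false, false) l n))] := nw n.+1 I.
  by rewrite size_nseq nth_mkseq // nth_nseq ltnSn /= => ->.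
split; first exact: wF 0%N.
rewrite size_nseq; apply: (@eq_from_nth _ (false, false)).
  by rewrite size_mkseq size_nseq.
move=> i; rewrite size_mkseq => ni; rewrite nth_mkseq // nth_nseq ni.
(* The cylinders also fix the actions; staying in [false] forces each action to be [false]. *)
have a0 := leave_step i pw; rewrite !wF /= in a0; have /= := wF i.+1.
by move: a0; case: (w.2 i) => a t /= <- ->.
Qed.

Lemma buchi_false (w : runs M) : infinite_path (false : state M) w ->
  buchi [set (false : state M)]%SET w <-> never_leave w.
Proof.
move=> pw; split=> [bw|/(never_leaveP pw) wF n]; last first.
  by exists n; rewrite // wF inE.
apply/never_leaveP => // n; apply/negbTE/negP => wn.
have [m nm] := bw n.
by rewrite inE (leave_absorbing pw nm wn).
Qed.

Lemma buchi_true (w : runs M) : infinite_path (false : state M) w ->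
  buchi [set (true : state M)]%SET w <-> (~` never_leave) w.
Proof.
move=> pw; split=> [bw /(never_leaveP pw) wF|nw n].
  by have [m _] := bw 0%N; rewrite wF inE.
have [k wk] : exists k, state_at w k = true :> bool.
  apply: contrapT => nk; apply/nw/never_leaveP => // k.
  by apply/negbTE/negP => wk; apply: nk; exists k.
exists (maxn n k); first exact: leq_maxl.
by rewrite inE (leave_absorbing pw (leq_maxr n k) wk).
Qed.

(** * The probability of never leaving under a given scheduler *)

Section wait_prob.
Context (sigma : scheduler M).

Definition wait_prob n : R := \prod_(i < n) sigma (wait i) false.

Lemma cyl_prob_wait n : cyl_prob sigma false (wait n) = wait_prob n.
Proof.
rewrite /cyl_prob eqxx mul1r.
(* Generalised over the number [k] of steps already waited, since [ext_prob] moves each step into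
   the history. *)
suff H k : ext_prob sigma (wait k) (nseq n (false, false)) =
    \prod_(i < n) sigma (wait (k + i)) false by exact: (H 0%N).
elim: n k => [|n IH] k; first by rewrite big_ord0.
rewrite big_ord_recl addn0 /= last_state_wait mulr1; congr (_ * _).
rewrite -cats1 -(nseqD k 1) addn1 IH.
by apply: eq_bigr => i _; rewrite addSnnS.
Qed.

Definition never_leave_prob : R :=
  fine (path_measure sigma false never_leave).

Lemma Pr_buchi_false :
  Pr_buchi sigma false [set (false : state M)]%SET = never_leave_prob.
Proof.
congr fine; apply: eq_path_measure; first exact: buchi_measurable.
  exact: never_leave_measurable.
exact: buchi_false.
Qed.

Lemma Pr_buchi_true :
  Pr_buchi sigma false [set (true : state M)]%SET = 1 - never_leave_prob.
Proof.
rewrite /Pr_buchi (@eq_path_measure _ _ _ _ _ (~` never_leave)).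
- rewrite probability_setC; last exact: never_leave_measurable.
  rewrite fineB //.
  by apply: fin_num_measure; exact: never_leave_measurable.
- exact: buchi_measurable.
- by apply: measurableC; exact: never_leave_measurable.
exact: buchi_true.
Qed.

Lemma approx_eq_never_leave :
  approx_eq 0 (Pr_buchi sigma false [set (false : state M)]%SET)
    (Pr_buchi sigma false [set (true : state M)]%SET) <-> never_leave_prob = 2^-1.
Proof.
rewrite /approx_eq Pr_buchi_false Pr_buchi_true normr_le0 subr_eq0.
by split=> [/eqP|->]; [lra|apply/eqP; lra].
Qed.

(** Continuity from above of the path measure along the decreasing cylinders of [wait n]. *)
Lemma cvg_wait_prob : wait_prob n @[n --> \oo] --> never_leave_prob.
Proof.
have -> : wait_prob =
    fine \o (path_measure sigma false \o fun n => cylinder (wait n)).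
  apply/funext => n; rewrite -cyl_prob_wait.
  exact: (congr1 fine (esym (path_measureE sigma false (wait n)))).
apply: fine_cvg; rewrite fineK; last first.
  by apply: fin_num_measure; exact: never_leave_measurable.
apply: nonincreasing_cvg_mu.
- apply: le_lt_trans (probability_le1 _ _) (ltry 1).
  exact: cylinder_measurable.
- by move=> n; exact: cylinder_measurable.
- exact: never_leave_measurable.
move=> m n mn; apply/subsetPset => w [w1 w2]; split=> //.
have := congr1 (take m) w2; rewrite !size_nseq -map_take take_iota.
by rewrite (minn_idPl mn) take_nseq.
Qed.

Lemma never_leave_prob_unique l :
  wait_prob n @[n --> \oo] --> l -> never_leave_prob = l.
Proof. by move=> cl; apply: cvg_unique cvg_wait_prob cl. Qed.

Lemma never_leave_prob_eventually N l :
  (forall n, (N <= n)%N -> wait_prob n = l) -> never_leave_prob = l.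
Proof.
move=> Nl; apply: never_leave_prob_unique; apply: cvg_near_cst.
by exists N => // n /= /Nl.
Qed.

Lemma never_leave_prob_memoryless : memoryless sigma ->
  never_leave_prob = 0 \/ never_leave_prob = 1.
Proof.
move=> mem; pose p := sigma (wait 0) false.
have wE n : wait_prob n = p ^+ n.
  rewrite /wait_prob (eq_bigr (fun=> p)) => [|i _].
    by rewrite prodr_const card_ord.
  (* All waiting histories end in [false], so every factor is the same [p]. *)
  by apply: mem; rewrite ?wait_fpath ?last_state_wait.
have p0 : 0 <= p by apply: sched_ge0; exact: wait_fpath.
have p1 : p <= 1.
  rewrite -(sched_sum sigma (wait_fpath 0)) big_bool lerDr.
  by apply: sched_ge0; exact: wait_fpath.
move: p1; rewrite le_eqVlt => /predU1P[p1|p1]; [right|left].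
  by apply: (@never_leave_prob_eventually 0) => n _; rewrite wE p1 expr1n.
apply: never_leave_prob_unique; rewrite (funext wE); apply: cvg_expr.
by rewrite ger0_norm.
Qed.

Lemma never_leave_prob_deterministic : deterministic sigma ->
  never_leave_prob = 0 \/ never_leave_prob = 1.
Proof.
move=> det.
have [[i i0]|all1] := pselect (exists i, sigma (wait i) false = 0);
  [left|right].
  (* The zero factor of index [i] occurs in every product of more than [i] factors. *)
  apply: (@never_leave_prob_eventually i.+1) => n lin.
  by rewrite /wait_prob (bigD1 (Ordinal lin)) //= i0 mul0r.
apply: (@never_leave_prob_eventually 0) => n _.
apply: big1 => i _; have [a aE] := det _ (wait_fpath i).
have := aE false; case: eqP => // _ E.
by case: all1; exists i.
Qed.

End wait_prob.

(** * The scheduler that tosses a single coin *)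

Definition coin (h : history M) (a : act M) : R :=
  if h.2 is [::] then 2^-1 else (a == false)%:R.

Lemma coin_ge0 (h : history M) (a : act M) : is_fpath h -> 0 <= coin h a.
Proof. by move=> _; rewrite /coin; case: h.2 => *; rewrite ?invr_ge0 ler0n. Qed.

Lemma coin_sum (h : history M) : is_fpath h -> \sum_a coin h a = 1.
Proof.
move=> _; rewrite big_bool /coin; case: h.2 => [|_ _] /=; first lra.
by rewrite add0r.
Qed.

Lemma coin_enabled (h : history M) (a : act M) :
  is_fpath h -> a \notin enabled (last_state h) -> coin h a = 0.
Proof. by move=> _; rewrite inE leave_trans_sum eqxx. Qed.

Definition coin_scheduler : scheduler M :=
  Scheduler coin_ge0 coin_sum coin_enabled.

Lemma never_leave_prob_coin : never_leave_prob coin_scheduler = 2^-1.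
Proof.
(* The products are constant only from length 1 on: the empty one is 1, the first factor is 1/2 and
   all later factors are 1. *)
apply: (@never_leave_prob_eventually _ 1) => -[//|n] _.
by rewrite /wait_prob big_ord_recl big1 ?mulr1.
Qed.

End wait_or_leave.

Theorem theorem6p24 (R : realType) :
  exists (M : mdp R) (s : state M) (T1 T2 : {set state M}) (eps : R),
    [/\ 0 <= eps,
        exists sigma : scheduler M,
          approx_eq eps (Pr_buchi sigma s T1) (Pr_buchi sigma s T2),
        forall sigma : scheduler M, memoryless sigma ->
          ~ approx_eq eps (Pr_buchi sigma s T1) (Pr_buchi sigma s T2)
      & forall sigma : scheduler M, deterministic sigma ->
          ~ approx_eq eps (Pr_buchi sigma s T1) (Pr_buchi sigma s T2)].
Proof.
have half01 (c : R) : c = 0 \/ c = 1 -> c <> 2^-1 by case=> ->; lra.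
exists (leave_mdp R), false, [set (false : state (leave_mdp R))]%SET,
  [set (true : state (leave_mdp R))]%SET, 0; split=> //.
- exists (coin_scheduler R).
  by apply/approx_eq_never_leave; exact: never_leave_prob_coin.
- move=> sigma mem /approx_eq_never_leave; apply: half01.
  exact: never_leave_prob_memoryless.
- move=> sigma det /approx_eq_never_leave; apply: half01.
  exact: never_leave_prob_deterministic.
Qed.
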